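(* The following hold. (i) Let $\mathfrak{T}$ be a locally finite tree in which every vertex $x$ has a finite number $\nu(x)\ge 3$ of neighbours, and let $\omega$ be a fixed geodesic ray in $\mathfrak{T}$. Then the uncentred triangular maximal operator $\mathcal{U}$ (associated with $\omega$) is bounded on $L^p(\mathfrak{T})$ for every $p\in(1,\infty]$. (ii) If $b\ge2$ is an integer, then the uncentred triangular maximal operator $\mathcal{U}$ is not of weak type $(1,1)$ on the homogeneous tree $\mathfrak{T}_b$.
   Context: A tree is a connected graph with no loops (cycles); it is identified with its set of vertices, endowed with the graph distance $d$ and the counting measure $\mu$; $|E|$ denotes the cardinality of $E\subseteq\mathfrak{T}$, and $L^p(\mathfrak{T})=L^p(\mathfrak{T},\mu)$. The number $\nu(x)$ of neighbours of $x$ is finite for every $x$, but $\nu$ need not be bounded on $\mathfrak{T}$. For an integer $b\ge2$, $\mathfrak{T}_b$ denotes the homogeneous tree, in which every vertex has exactly $b+1$ neighbours. A geodesic ray is a sequence $\omega=\{x_m:m\in\mathbb{N}\}$ of vertices with $d(x_i,x_j)=|i-j|$ for all $i,j$. In each tree under consideration, fix such a ray $\omega$. The height function is $h(x)=\lim_{m\to\infty}\big(m-d(x,x_m)\big)\in\mathbb{Z}$. Each vertex $x$ has exactly one neighbour of height $h(x)+1$, and its other $\nu(x)-1$ neighbours, called the successors of $x$, have height $h(x)-1$. Let $s^0(x)=\{x\}$, let $s^1(x)$ be the set of successors of $x$, and $s^k(x)=\bigcup_{y\in s^{k-1}(x)}s^1(y)$ for $k\ge2$. For an integer $R\ge0$,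 the triangle with vertex $x$ and height $R$ is $T_R(x)=\bigcup_{j=0}^R s^j(x)$; a triangle is any set of this form. The uncentred triangular maximal operator is $$\mathcal{U}f(x)=\sup_{T\ni x}\frac{1}{|T|}\int_{T}|f|\,d\mu ,$$ where $T$ ranges over all triangles containing $x$. It is bounded on $L^p$ if there is a constant $C$ with $\|\mathcal{U}f\|_p\le C\|f\|_p$ for all $f\in L^p(\mathfrak{T})$; it is of weak type $(1,1)$ if there is a constant $C$ with $|\{x:\mathcal{U}f(x)>\alpha\}|\le C\|f\|_1/\alpha$ for all $\alpha>0$ and $f\in L^1(\mathfrak{T})$. *)

(* Defs.v *)
From HB Require Import structures.
From mathcomp Require Import all_boot all_order all_algebra finmap.
From mathcomp Require Import all_classical all_reals all_analysis.

Set Implicit Arguments.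
Unset Strict Implicit.
Unset Printing Implicit Defensive.

Import Order.TTheory GRing.Theory Num.Theory.
Local Open Scope classical_set_scope.
Local Open Scope ring_scope.

(* A tree is a connected graph without cycles.  MathComp-Analysis requires
   measurable spaces to be pointed, hence the pointed type of vertices; this is
   only nonemptiness.  A cycle of size 1 would be a loop and a cycle of size 2
   is an edge traversed back and forth, so genuine cycles have size >= 3. *)
Record tree := Tree {
  vertex : pointedType;
  adj : rel vertex;
  adj_sym : symmetric adj;
  adj_irrefl : irreflexive adj;
  adj_connected : forall x y : vertex, exists p : seq vertex,
    path adj x p /\ last x p = y;
  adj_acyclic : forall c : seq vertex,
    cycle adj c -> uniq c -> (size c <= 2)%N }.

(* The alias carries the discrete sigma-algebra. *)
Definition vertices (T : tree) : Type := vertex T.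
Coercion vertices : tree >-> Sortclass.

HB.instance Definition _ (T : tree) := Pointed.on (vertices T).
HB.instance Definition _ (T : tree) :=
  @isMeasurable.Build default_measure_display (vertices T)
    discrete_measurable discrete_measurable0
    discrete_measurableC discrete_measurableU.

Section graph.
Variable T : tree.

Definition joined_by (x y : T) (n : nat) : bool :=
  `[< exists p : seq T, [/\ path (@adj T) x p, last x p = y & size p = n] >].

Lemma joined_by_ex (x y : T) : exists n, joined_by x y n.
Proof.
by have [p [xp py]] := adj_connected x y; exists (size p); apply/asboolP; exists p.
Qed.

Definition gdist (x y : T) : nat := ex_minn (joined_by_ex x y).

Definition neighbours (x : T) : set T := [set y | adj x y].

Definition locally_finite : Prop := forall x : T, finite_set (neighbours x).

(* Junk value 0 when x has infinitely many neighbours. *)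
Definition nu (x : T) : nat := #|` fset_set (neighbours x) |.

Definition geodesic_ray (w : nat -> T) : Prop :=
  forall i j : nat, gdist (w i) (w j) = `|i%:Z - j%:Z|%N.

End graph.

Definition homogeneous (b : nat) (T : tree) : Prop :=
  locally_finite T /\ forall x : T, nu x = b.+1.

Section triangles.
Variables (T : tree) (w : nat -> T).

(* The limit is taken in the discrete space of integers; 0 is a junk value when
   there is none. *)
Definition height (x : T) : int :=
  xget 0 [set l : discrete_topology int |
    (m%:Z - (gdist x (w m))%:Z : discrete_topology int) @[m --> \oo] --> l].

Definition successors (x : T) : set T :=
  [set y | adj x y /\ height y = height x - 1].

Fixpoint nsuccessors (k : nat) (x : T) : set T :=
  if k is k'.+1 then \bigcup_(y in nsuccessors k' x) successors y else [set x].

Definition triangle (r : nat) (x : T) : set T :=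
  \bigcup_(j in [set j : nat | (j <= r)%N]) nsuccessors j x.

Definition is_triangle (E : set T) : Prop := exists x r, E = triangle r x.

End triangles.

Section maximal_operator.
Local Open Scope ereal_scope.
Variables (R : realType) (T : tree) (w : nat -> T).

Local Notation mu := (@counting T R).

Definition average (f : T -> R) (E : set T) : \bar R :=
  (mu E)^-1 * \int[mu]_(y in E) `|(f y)%:E|.

Definition maximal (f : T -> R) (x : T) : \bar R :=
  ereal_sup [set average f E | E in [set E | is_triangle w E /\ E x]].

Definition bounded_on_Lp (p : \bar R) : Prop :=
  exists C : R, forall f : T -> R, finite_norm mu p f ->
    'N[mu]_p[maximal f] <= C%:E * 'N[mu]_p[EFin \o f].

Definition weak_type_1_1 : Prop :=
  exists C : R, forall (f : T -> R) (a : R), finite_norm mu 1 f -> (0 < a)%R ->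
    mu [set x | a%:E < maximal f x] <= C%:E * 'N[mu]_1[EFin \o f] / a%:E.

End maximal_operator.

(* Main.v *)
(* Let s^k(x) be the k-th generation below x and N_k(x) = |s^k(x)| >= 2^k.  On
   each horocycle the sets s^k(x) form a filtration, with maximal function
   M f(y) = sup_k of the average of f over the member s^k containing y; it is
   bounded on L^p by Doob's inequality, proved here by Burkholder's method.

   (i) Let y be j generations below x and j <= n.  In the average of |f| over
   T_n(x), split the generations k <= n.
   - For k >= j, put i = k - j: the average of |f| over s^k(x) is at most
     M|f|(z) for each of the at least 2^i points z of s^i(y), so its p-th power
     is at most 2^-i times the sum of (M|f|)^p over s^i(y).
   - For k < j, put i = j - k and spread the mass f(u) uniformly over s^i(u):
     this gives F_i with the same sum over s^j(x) as f over s^k(x), whence a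
     contribution at most M F_i(y), while ||F_i||_p^p <= 2^(-i(p-1)) ||f||_p^p.
   Both families are geometrically summable when p > 1.

   (ii) For the point mass at o, the maximal function is at least 1/|T_n| on the
   n + 1 disjoint sets s^n(x), where x runs over the ancestors of o up to order
   n.  Each has b^n elements and |T_n| <= 2 b^n, so a weak type constant would
   be at least of order n. *)
Require Import Defs.
From HB Require Import structures.
From mathcomp Require Import all_boot all_order all_algebra finmap zify ring lra.
From mathcomp Require Import all_classical all_reals all_analysis ess_sup_inf.

Set Implicit Arguments.
Unset Strict Implicit.
Unset Printing Implicit Defensive.

Import Order.TTheory GRing.Theory Num.Theory.
Local Open Scope classical_set_scope.
Local Open Scope ring_scope.

(** * Distance and height in a tree *)

Section tree_distance.
Variable T : tree.
Implicit Types (x y z a b : T) (p : seq T).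

Lemma gdist_path x y :
  exists p, [/\ path (@adj T) x p, last x p = y & size p = gdist x y].
Proof. by rewrite /gdist; case: ex_minnP => n /asboolP. Qed.

Lemma gdist_le x p : path (@adj T) x p -> (gdist x (last x p) <= size p)%N.
Proof.
move=> xp; rewrite /gdist; case: ex_minnP => n _; apply.
by apply/asboolP; exists p.
Qed.

Lemma gdist_eq0 x y : gdist x y = 0%N -> x = y.
Proof.
by have [p [_ <- <-]] := gdist_path x y => /size0nil ->.
Qed.

Lemma gdist_triangle x y z : (gdist x z <= gdist x y + gdist y z)%N.
Proof.
have [p [xp py <-]] := gdist_path x y; have [q [yq <- <-]] := gdist_path y z.
rewrite -size_cat -{1}py -last_cat; apply: gdist_le.
by rewrite cat_path xp py.
Qed.

Lemma gdist_adj x y z : adj x y -> (gdist x z <= (gdist y z).+1)%N.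
Proof.
move=> xy; have [p [yp <- <-]] := gdist_path y z.
have : path (@adj T) x (y :: p) by rewrite /= xy.
by move/gdist_le.
Qed.

Lemma gdist_step x z n : gdist x z = n.+1 ->
  exists2 y, adj x y & gdist y z = n.
Proof.
move=> xz; have [p [xp pz ps]] := gdist_path x z.
case: p => [|y p] /= in xp pz ps; first by rewrite xz in ps.
move/andP: xp => [xy yp]; exists y => //.
have := gdist_adj z xy; have := gdist_le yp.
by rewrite pz xz; lia.
Qed.

(* Descending from a and from b towards z until the two geodesics meet. *)
Lemma equidistant_bridge z n a b : a != b -> gdist a z = n -> gdist b z = n ->
  exists p, [/\ path (@adj T) a (rcons p b), p != [::], uniq p
    & all (fun v => gdist v z < n)%N p].
Proof.
elim: n a b => [|n IHn] a b ab az bz.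
  by rewrite (gdist_eq0 az) (gdist_eq0 bz) eqxx in ab.
have [a' aa' a'z] := gdist_step az; have [b' bb' b'z] := gdist_step bz.
have b'b : adj b' b by rewrite adj_sym.
have [a'b'|a'b'] := eqVneq a' b'.
  by exists [:: a']; rewrite /= aa' a'b' b'b b'z ltnSn.
have [p [a'p pN0 up pn]] := IHn _ _ a'b' a'z b'z.
have ltn_notin v : gdist v z = n -> v \notin p.
  by move=> vz; apply/negP => /(allP pn); rewrite vz ltnn.
exists (a' :: rcons p b'); split => //.
- by rewrite /= rcons_path aa' a'p last_rcons.
- by rewrite /= mem_rcons inE (negPf a'b') rcons_uniq !ltn_notin.
- rewrite /= all_rcons a'z b'z ltnSn /=.
  by apply: sub_all pn => v /ltnW.
Qed.

(** Were the two distances equal, the edge would close a bridge between its ends into a cycle of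
    length at least 3. *)
Lemma gdist_adj_neq x y z : adj x y -> gdist x z != gdist y z.
Proof.
move=> xy; apply/eqP => xyz.
have xNy : x != y by apply/eqP => e; rewrite e adj_irrefl in xy.
have [p [xp pN0 up pz]] := equidistant_bridge xNy (erefl _) (esym xyz).
have := @adj_acyclic T (x :: rcons p y).
rewrite /= rcons_path last_rcons xp adj_sym xy mem_rcons inE (negPf xNy) /=.
rewrite rcons_uniq up size_rcons andbT.
have ltn_notin v : gdist v z = gdist x z -> v \notin p.
  by move=> vz; apply/negP => /(allP pz); rewrite vz ltnn.
by rewrite !ltn_notin// => /(_ isT isT); case: p pN0 {xp up pz ltn_notin}.
Qed.

(** Two distinct such neighbours would be joined by a bridge strictly closer to [z], which [x] would
    close into a cycle. *)
Lemma adj_closer_unique x a b z : adj x a -> adj x b ->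
  gdist a z = gdist b z -> (gdist a z < gdist x z)%N -> a = b.
Proof.
move=> xa xb abz axz; apply/eqP/negP => /negP aNb.
have [p [ap pN0 up pz]] := equidistant_bridge aNb (erefl _) (esym abz).
have := @adj_acyclic T (x :: a :: rcons p b).
rewrite /= rcons_path last_rcons xa ap adj_sym xb /= !inE !mem_rcons !inE.
rewrite rcons_uniq up size_rcons andbT.
have leq_notin v : (gdist a z <= gdist v z)%N -> v \notin p.
  by move=> vz; apply/negP => /(allP pz); rewrite ltnNge vz.
have -> : x \in p = false by apply/negbTE; apply: leq_notin; apply: ltnW.
rewrite (negPf aNb) !leq_notin -?abz//=.
have -> : x == a = false by apply/eqP => e; rewrite e ltnn in axz.
have -> : x == b = false by apply/eqP => e; rewrite abz e ltnn in axz.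
by move=> /(_ isT isT).
Qed.

End tree_distance.

(** * Height, parents and generations *)

Section horofunction.
Variables (T : tree) (w : nat -> T).
Hypothesis ray : geodesic_ray w.
Implicit Types x y : T.

(** By the triangle inequality the integers m - d(x, w_m) do not decrease with m and are at most
    d(w_0, x), so they are eventually constant. *)
Lemma heightE x : exists N, forall m, (N <= m)%N ->
  height w x = m%:Z - (gdist x (w m))%:Z.
Proof.
set D := gdist (w 0%N) x.
have D_ge m : (m <= D + gdist x (w m))%N.
  have := gdist_triangle (w 0%N) x (w m).
  by rewrite ray sub0r abszN absz_nat.
(* The gap between the sequence and its upper bound [D]; by [D_ge] the natural subtraction does not
   truncate. Its least value, once reached, persists. *)
have exP : exists n, `[< exists m, (D + gdist x (w m) - m)%N = n >].
  by exists (D + gdist x (w 0%N) - 0)%N; apply/asboolP; exists 0%N.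
have [n /asboolP[N DN] minn] := ex_minnP exP.
have decr m : (gdist x (w m.+1) <= (gdist x (w m)).+1)%N.
  apply: leq_trans (gdist_triangle x (w m) (w m.+1)) _.
  by rewrite ray; lia.
have cst m : (N <= m)%N -> (D + gdist x (w m) - m)%N = n.
  move=> Nm; apply/eqP; rewrite eqn_leq minn ?andbT; last by apply/asboolP; exists m.
  rewrite -(subnKC Nm); elim: (m - N)%N => [|k IHk]; first by rewrite addn0 DN.
  rewrite addnS; have := decr (N + k)%N; have := D_ge (N + k)%N; lia.
pose c : discrete_topology int := D%:Z - n%:Z.
suff : [set l : discrete_topology int |
    (m%:Z - (gdist x (w m))%:Z : discrete_topology int) @[m --> \oo] --> l] (height w x).
  by move=> /discrete_cvg[M _ hM]; exists M => m Mm; apply/esym/hM.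
rewrite /height; case: xgetP => // /(_ c)[].
apply/discrete_cvg; exists N => // m /= Nm.
by have := cst _ Nm; have := D_ge m; rewrite /c; lia.
Qed.

Lemma height_near x y : exists m, 
  [/\ height w x = m%:Z - (gdist x (w m))%:Z, 
     height w y = m%:Z - (gdist y (w m))%:Z & (0 < gdist x (w m))%N].
Proof.
have [N hN] := heightE x; have [M hM] := heightE y.
(* The last entry makes m exceed h(x), so that d(x, w_m) is positive. *)
exists (maxn (maxn N M) `|height w x|.+1); split.
- by apply: hN; lia.
- by apply: hM; lia.
- by have := hN (maxn (maxn N M) `|height w x|.+1); lia.
Qed.

Lemma height_adj x y : adj x y ->
  height w y = height w x + 1 \/ height w y = height w x - 1.
Proof.
move=> xy; have [m [-> -> _]] := height_near x y.
have := gdist_adj (w m) xy; have := gdist_adj_neq (w m) xy.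
by rewrite adj_sym in xy; have := gdist_adj (w m) xy; lia.
Qed.

Lemma height_ge x m : m%:Z - (gdist x (w m))%:Z <= height w x.
Proof.
have [N hN] := heightE x; rewrite (hN (m + N)%N) ?leq_addl//.
have := gdist_triangle x (w m) (w (m + N)%N); rewrite ray; lia.
Qed.

(** The first step of a geodesic towards a far vertex of the ray gains at least 1 in height by
    [height_ge], hence exactly 1. *)
Lemma parent_exists x : exists y, adj x y /\ height w y = height w x + 1.
Proof.
have [m [hx _ xm]] := height_near x x.
have [y xy yn] := gdist_step (esym (prednK xm)).
exists y; split => //; have [//|] := height_adj xy.
by have := height_ge y m; lia.
Qed.

Lemma parent_unique x y z : adj x y -> adj x z ->
  height w y = height w x + 1 -> height w z = height w x + 1 -> y = z.
Proof.
move=> xy xz hy hz.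
have [Nx hNx] := heightE x; have [Ny hNy] := heightE y; have [Nz hNz] := heightE z.
pose m := maxn Nx (maxn Ny Nz).
have := hNx m; have := hNy m; have := hNz m; rewrite hy hz => mz my mx.
by apply: (adj_closer_unique (z := w m) xy xz); lia.
Qed.

Definition parent x : T := xget x [set y | adj x y /\ height w y = height w x + 1].

Lemma parentP x : adj x (parent x) /\ height w (parent x) = height w x + 1.
Proof. by rewrite /parent; case: xgetP => // /= H; have [y /H] := parent_exists x. Qed.

(** Successors become fibres of a single map, so that generations are fibres of its iterates. *)
Lemma successorsE x y : successors w x y <-> parent y = x.
Proof.
have [yp hp] := parentP y; split=> [[xy hy]|<-].
  by apply: (@parent_unique y) => //; rewrite 1?adj_sym// hy addrNK.
by split; rewrite 1?adj_sym// hp addrK.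
Qed.

Lemma nsuccessorsE k x y : nsuccessors w k x y <-> iter k parent y = x.
Proof.
elim: k x y => [|k IHk] x y /=; first by split => ->.
rewrite -iterS iterSr; split=> [[z /IHk zx /successorsE ->//]|yx].
exists (parent y); first by apply/IHk.
by apply/successorsE.
Qed.

Lemma neighboursE x : neighbours x = parent x |` successors w x.
Proof.
have [xp hp] := parentP x.
apply/seteqP; split=> [y /= xy|y /= [->//|[]//]].
have [hy|hy] := height_adj xy; last by right.
by left; exact: (@parent_unique x).
Qed.

Lemma height_iter_parent k x : height w (iter k parent x) = height w x + k%:Z.
Proof.
elim: k => [|k IHk]; first by rewrite addr0.
by rewrite iterS (parentP _).2 IHk -addrA intS; congr (_ + _); rewrite addrC.
Qed.

End horofunction.

(** Every vertex ends a path from the base point, and paths of a given length have finitely many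
    ends. Countability turns counting integrals into sums. *)
Lemma locally_finite_countable (T : tree) : locally_finite T ->
  countable [set: T].
Proof.
move=> fT; pose B n := [set y : T | exists p,
  [/\ path (@adj T) point p, last point p = y & size p = n]].
have finB n : finite_set (B n).
  elim: n => [|n IHn].
    by apply: sub_finite_set (finite_set1 (point : T)) => y [p [_ <- /size0nil ->]].
  have : finite_set (\bigcup_(z in B n) neighbours z) by apply: bigcup_finite.
  apply: sub_finite_set => y [p [xp py ps]].
  case/lastP: p => [|p v] in xp py ps; first by [].
  move: xp; rewrite rcons_path last_rcons size_rcons in py ps * => /andP[xp pv].
  by exists (last point p); [exists p; split => //; case: ps|rewrite -py].
have -> : [set: T] = \bigcup_n B n.
  apply/seteqP; split=> // y _; have [p [xp py]] := adj_connected point y.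
  by exists (size p) => //; exists p.
by apply: bigcup_countable => // n _; apply: finite_set_countable.
Qed.

(** * Doob's inequality on the generations below a vertex *)

Lemma uniq_flatten_map (S T : eqType) (F : S -> seq T) (g : T -> S) (s : seq S) :
  uniq s -> (forall c, uniq (F c)) -> (forall c y, y \in F c -> g y = c) ->
  uniq (flatten [seq F c | c <- s]).
Proof.
move=> + uF gF; elim: s => //= c s IHs /andP[cs us].
rewrite cat_uniq uF IHs// andbT.
apply/hasPn => y /flatten_mapP[d ds yd]; apply: contraNN cs => /gF <-.
by rewrite (gF _ _ yd).
Qed.

(** * Generations under an abstract parent map *)

Section descendants.
Variables (T : choiceType) (par : T -> T) (ch : T -> seq T).
Hypothesis ch_uniq : forall x, uniq (ch x).
Hypothesis mem_ch : forall x y, (y \in ch x) = (par y == x).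
Hypothesis ch_size : forall x, (2 <= size (ch x))%N.

(** Peels off the generation nearest to [x], so that induction on [k] follows the filtration from
    coarse to fine. *)
Fixpoint desc (k : nat) (x : T) : seq T :=
  if k is k'.+1 then flatten [seq desc k' c | c <- ch x] else [:: x].

Lemma mem_desc k x y : (y \in desc k x) = (iter k par y == x).
Proof.
elim: k x y => [|k IHk] x y; first by rewrite inE.
rewrite /=; apply/flatten_mapP/eqP => [[c]|<-].
  by rewrite mem_ch IHk => /eqP <- /eqP ->.
by exists (iter k par y); rewrite ?mem_ch ?IHk.
Qed.

Lemma desc_uniq k x : uniq (desc k x).
Proof.
elim: k x => //= k IHk x; apply: (uniq_flatten_map (g := iter k par)) => //.
by move=> c y; rewrite mem_desc => /eqP.
Qed.

Lemma big_desc (R : Type) (idx : R) (op : Monoid.com_law idx) k x (F : T -> R) :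
  \big[op/idx]_(y <- desc k.+1 x) F y =
  \big[op/idx]_(c <- ch x) \big[op/idx]_(y <- desc k c) F y.
Proof. by rewrite /= big_flatten big_map. Qed.

Variable R : realType.

Lemma sum_descD k l x (F : T -> R) :
  \sum_(y <- desc (k + l) x) F y =
  \sum_(u <- desc k x) \sum_(y <- desc l u) F y.
Proof.
elim: k x => [|k IHk] x; first by rewrite big_seq1.
by rewrite addSn !big_desc; apply: eq_bigr => c _; exact: IHk.
Qed.

Definition ndesc k x : R := (size (desc k x))%:R.

Lemma ndescE k x : ndesc k x = \sum_(y <- desc k x) 1.
Proof. by rewrite /ndesc big_const_seq count_predT iter_addr_0. Qed.

Lemma ndesc_geX k x : 2 ^+ k <= ndesc k x.
Proof.
elim: k x => [|k IHk] x; first by rewrite /ndesc.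
rewrite ndescE big_desc.
apply: (@le_trans _ _ (\sum_(c <- ch x) 2 ^+ k)); last first.
  by apply: ler_sum => c _; rewrite -ndescE.
rewrite big_const_seq count_predT iter_addr_0 exprS -(mulr_natl (2 ^+ k) (size _)).
by apply: ler_wpM2r; rewrite ?exprn_ge0 ?ler_nat.
Qed.

Lemma ndesc_gt0 k x : 0 < ndesc k x.
Proof. by apply: lt_le_trans (ndesc_geX k x); rewrite exprn_gt0. Qed.

Implicit Types f : T -> R.

Definition avg k f x : R := (\sum_(y <- desc k x) f y) / ndesc k x.

Lemma avgE k f x : \sum_(y <- desc k x) f y = ndesc k x * avg k f x.
Proof. by rewrite /avg mulrC divfK// gt_eqF// ndesc_gt0. Qed.

Lemma avg_ge0 k f x : (forall y, 0 <= f y) -> 0 <= avg k f x.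
Proof. by move=> f0; rewrite divr_ge0 ?sumr_ge0// ltW// ndesc_gt0. Qed.

Section doob.
Variable p : R.
Hypothesis p1 : 1 < p.
Let p0 : 0 < p. Proof. exact: lt_trans p1. Qed.
Let q := p / (p - 1).
Let q0 : 0 < q. Proof. by rewrite divr_gt0// subr_gt0. Qed.

(* Burkholder's function for Doob's inequality: affine in the current average
   [m], and not increased when the running maximum [a] is updated to [m]. *)
Let v (a m : R) := a `^ p - q * a `^ (p - 1) * m.

Lemma young_powR (a m : R) : 0 <= a -> 0 <= m ->
  m * a `^ (p - 1) <= m `^ p / p + a `^ p / q.
Proof.
move=> a0 m0.
have pN1 : p - 1 != 0 by rewrite gt_eqF// subr_gt0.
have pq : (p - 1) * q = p by rewrite /q mulrC divfK.
have := @conjugate_powR R m (a `^ (p - 1)) p q m0 (powR_ge0 _ _) p0 q0.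
rewrite -powRrM pq; apply.
by rewrite /q; field; rewrite pN1 gt_eqF.
Qed.

Let qE : q / p = q - 1.
Proof.
have pN1 : p - 1 != 0 by rewrite gt_eqF// subr_gt0.
by rewrite /q; field; rewrite pN1 gt_eqF.
Qed.

Let young_powRq (a m : R) : 0 <= a -> 0 <= m ->
  q * a `^ (p - 1) * m <= (q - 1) * m `^ p + a `^ p.
Proof.
move=> a0 m0; have := young_powR a0 m0; rewrite -(ler_pM2l q0).
have -> : q * (m `^ p / p + a `^ p / q) = q / p * m `^ p + a `^ p.
  by field; rewrite !gt_eqF.
by rewrite qE; apply: le_trans; rewrite mulrA mulrAC.
Qed.

Let v_update (a m : R) : 0 <= a -> 0 <= m -> v (Num.max a m) m <= v a m.
Proof.
move=> a0 m0; have [//|am] := leP m a.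
have mm : q * m `^ (p - 1) * m = q * m `^ p.
  by rewrite -mulrA (mulrC _ m) mulr_powRB1.
by have := young_powRq a0 m0; rewrite /v mm; lra.
Qed.

(** The running maximum of the martingale of averages, from the ancestor of order [k] down to [y];
    the argument [a] carries the maximum already reached. *)
Fixpoint dmax (k : nat) (a : R) f (y : T) : R :=
  let a' := Num.max a (avg k f (iter k par y)) in
  if k is k'.+1 then dmax k' a' f y else a'.

Lemma dmax_ge k a f y : a <= dmax k a f y.
Proof.
by elim: k a => [|k IHk] a /=; [|apply: le_trans (IHk _)]; rewrite le_max lexx.
Qed.

Lemma le_dmax k a b f y : a <= b -> dmax k a f y <= dmax k b f y.
Proof.
by elim: k a b => [|k IHk] a b ab /=; [|apply: IHk]; rewrite ge_max !le_max ab lexx orbT.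
Qed.

Lemma dmax_le k l a f y : (k <= l)%N -> dmax k a f y <= dmax l a f y.
Proof.
move/subnK <-; elim: (l - k)%N => //= n; move/le_trans; apply.
by apply: le_dmax; rewrite le_max lexx.
Qed.

Lemma avg_le_dmax k a f y : avg k f (iter k par y) <= dmax k a f y.
Proof.
by case: k => [|k] /=; [|apply: le_trans (dmax_ge _ _ _ _)]; rewrite le_max lexx orbT.
Qed.

(** The supermartingale property: updating the maximum does not increase [v], and then, [v] being
    affine in the average, passing to the children preserves its weighted sum. *)
Lemma dmax_bellman k a f x : (forall y, 0 <= f y) -> 0 <= a ->
  \sum_(y <- desc k x)
    (dmax k a f y `^ p - q * dmax k a f y `^ (p - 1) * f y) <=
  ndesc k x * v a (avg k f x).
Proof.
move=> f0; elim: k a x => [|k IHk] a x a0.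
  rewrite big_seq1 /= /ndesc mul1r.
  have -> : avg 0 f x = f x by rewrite /avg big_seq1 /ndesc divr1.
  exact: v_update.
apply: (@le_trans _ _
  (ndesc k.+1 x * v (Num.max a (avg k.+1 f x)) (avg k.+1 f x))); last first.
  by rewrite ler_pM2l ?ndesc_gt0// v_update// avg_ge0.
set a' := Num.max _ _; have a'0 : 0 <= a' by rewrite le_max a0.
have -> : ndesc k.+1 x * v a' (avg k.+1 f x) =
    \sum_(c <- ch x) ndesc k c * v a' (avg k f c).
  transitivity (\sum_(c <- ch x) (ndesc k c * a' `^ p -
      q * a' `^ (p - 1) * \sum_(y <- desc k c) f y)); last first.
    by apply: eq_bigr => c _; rewrite avgE /v; ring.
  rewrite sumrB -mulr_suml -mulr_sumr -big_desc avgE /v.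
  rewrite ndescE big_desc (eq_bigr (ndesc k)); last by move=> c _; rewrite ndescE.
  ring.
rewrite big_desc big_seq [leRHS]big_seq; apply: ler_sum => c cx.
apply: le_trans (IHk _ _ a'0); rewrite big_seq [leRHS]big_seq.
apply: ler_sum => y yc; rewrite /=.
(* All vertices below [c] share the ancestor [x] of order k + 1, hence the same updated maximum. *)
suff -> : par (iter k par y) = x by [].
by move: yc cx; rewrite mem_desc mem_ch => /eqP -> /eqP.
Qed.

(** Equals 2^p / (p - 1), which is what Young's inequality applied to 2f leaves in front of f^p. *)
Definition doob_cst : R := q / p * 2 `^ p.

Lemma doob_cst_ge0 : 0 <= doob_cst.
Proof. by rewrite mulr_ge0 ?powR_ge0// divr_ge0 ?ltW. Qed.

Lemma sum_dmax_powR k f x : (forall y, 0 <= f y) ->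
  \sum_(y <- desc k x) dmax k 0 f y `^ p <=
  doob_cst * \sum_(y <- desc k x) f y `^ p.
Proof.
move=> f0; have p10 : p - 1 != 0 by rewrite gt_eqF// subr_gt0.
(* Starting from a = 0, the right-hand side of [dmax_bellman] vanishes, as 0^(p-1) = 0 for p > 1. *)
have v0 m : v 0 m = 0 by rewrite /v (powR0 p10) (powR0 (lt0r_neq0 p0)) mulr0 mul0r subrr.
have := dmax_bellman k x f0 (lexx 0); rewrite v0 mulr0 => H.
rewrite mulr_sumr -subr_le0 -sumrB.
(* Doubling leaves room: by Young's inequality for 2f, the cross term costs one of the two copies of
   the p-th power of the maximum, plus a multiple of f^p. *)
suff : 2 * \sum_(y <- desc k x) (dmax k 0 f y `^ p - q * dmax k 0 f y `^ (p - 1) * f y) >=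
   \sum_(y <- desc k x) (dmax k 0 f y `^ p - doob_cst * f y `^ p).
  by move=> /le_trans; apply; rewrite pmulr_rle0.
rewrite mulr_sumr; apply: ler_sum => y _.
have d0 : 0 <= dmax k 0 f y by exact: dmax_ge.
have := young_powRq d0 (mulr_ge0 (ler0n R 2) (f0 y)).
rewrite powRM// /doob_cst qE; lra.
Qed.

End doob.

(** * Spreading mass downwards and averaging over triangles *)

Definition spread i f y : R := f (iter i par y) / ndesc i (iter i par y).

Lemma spread_ge0 i f y : (forall y, 0 <= f y) -> 0 <= spread i f y.
Proof. by move=> f0; rewrite divr_ge0// ltW// ndesc_gt0. Qed.

Lemma sum_spread i k f x :
  \sum_(y <- desc (k + i) x) spread i f y = \sum_(u <- desc k x) f u.
Proof.
rewrite sum_descD; apply: eq_bigr => u _.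
rewrite (eq_big_seq (fun=> f u / ndesc i u)).
  rewrite big_const_seq count_predT iter_addr_0 -mulr_natr.
  by rewrite divfK// gt_eqF// ndesc_gt0.
by move=> y; rewrite mem_desc /spread => /eqP ->.
Qed.

Definition tri n x := flatten [seq desc k x | k <- iota 0 n.+1].

Lemma big_tri n x (F : T -> R) :
  \sum_(y <- tri n x) F y = \sum_(k < n.+1) \sum_(y <- desc k x) F y.
Proof.
rewrite /tri big_flatten big_map.
by rewrite -(big_mkord predT (fun k => \sum_(y <- desc k x) F y)) /index_iota subn0.
Qed.

Lemma mem_tri n x y :
  y \in tri n x <-> exists2 k, (k <= n)%N & iter k par y = x.
Proof.
split=> [/flatten_mapP[k]|[k kn yx]].
  by rewrite mem_iota mem_desc add0n => kn /eqP; exists k.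
by apply/flatten_mapP; exists k; rewrite ?mem_iota ?mem_desc ?yx.
Qed.

(** Generations from j on cost at most [B] per vertex. The mass of generation k < j is that of a
    spread function on generation j, at most r^(j-k) B |s^j(x)|, and these bounds sum
    geometrically. *)
Lemma tri_avg_le r B j n f x : (forall y, 0 <= f y) -> 0 <= B -> 0 <= r < 1 ->
  (j <= n)%N ->
  (forall k, (j <= k)%N -> avg k f x <= B) ->
  (forall i, (i <= j)%N -> avg j (spread i f) x <= r ^+ i * B) ->
  \sum_(y <- tri n x) f y <= (1 + (1 - r)^-1) * B * (size (tri n x))%:R.
Proof.
move=> f0 B0 /andP[r0 r1] jn avgB spreadB.
have -> : (size (tri n x))%:R = \sum_(k < n.+1) ndesc k x.
  transitivity (\sum_(y <- tri n x) (1 : R)).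
    by rewrite big_const_seq count_predT iter_addr_0.
  by rewrite big_tri; apply: eq_bigr => k _; rewrite ndescE.
rewrite big_tri.
have geo m : \sum_(k < m) r ^+ (m - k) <= (1 - r)^-1.
  have c1 : (1 - r)^-1 * (1 - r) = 1 by rewrite mulVf// subr_eq0 gt_eqF.
  elim: m => [|m IHm]; first by rewrite big_ord0 invr_ge0 subr_ge0 ltW.
  rewrite big_ord_recr /= subSnn expr1 (eq_bigr (fun k : 'I_m => r * r ^+ (m - k))).
    by rewrite -mulr_sumr; nra.
  by move=> k _; rewrite subSn ?exprS// ltnW.
(* Generation j lies in the triangle, so all the generations above it can be charged to it. *)
have Nj : ndesc j x <= \sum_(k < n.+1) ndesc k x.
  rewrite (bigD1 (Ordinal (jn : (j < n.+1)%N)))//= lerDl.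
  by apply: sumr_ge0 => k _; rewrite ltW ?ndesc_gt0.
apply: (@le_trans _ _ (\sum_(k < n.+1)
   (B * ndesc k x + if (k < j)%N then ndesc j x * B * r ^+ (j - k) else 0))).
  apply: ler_sum => k _; have Nk0 := ndesc_gt0 k x.
  have Nj0 := ndesc_gt0 j x; case: ltnP => kj.
    rewrite -(sum_spread (j - k)) (subnKC (ltnW kj)) avgE -mulrA (mulrC B).
    rewrite ler_wpDl ?mulr_ge0 ?(ltW Nk0)// ler_pM2l//.
    by rewrite mulrC spreadB// leq_subr.
  by rewrite addr0 avgE mulrC ler_pM2r// avgB.
rewrite big_split /= -mulr_sumr -big_mkcond /=.
rewrite -(big_ord_widen _ (fun k => ndesc j x * B * r ^+ (j - k))); last exact: leqW.
rewrite -mulr_sumr; have := geo j; set X := \sum_(k < j) _ => Xc.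
have c0 : 0 <= (1 - r)^-1 by rewrite invr_ge0 subr_ge0 ltW.
have := ndesc_gt0 j x; move: Nj; set S := \sum_(k < _) _ => Nj Nj0.
have : ndesc j x * B * X <= S * B * (1 - r)^-1.
  apply: ler_pM => //; first by rewrite mulr_ge0// ltW.
    by apply: sumr_ge0 => k _; rewrite exprn_ge0.
  by rewrite ler_wpM2r.
lra.
Qed.

End descendants.

(** * Counting measure on the vertices *)

Section counting_integral.
Local Open Scope ereal_scope.
Variables (R : realType) (T : tree).
Hypothesis countT : countable [set: T].
Local Notation mu := (@counting T R).
Implicit Types (A : set T) (g : T -> \bar R) (s : seq T).

Lemma vertices_measurable A : measurable A.
Proof. by []. Qed.

Lemma integral_counting_set1 x g : 0 <= g x -> \int[mu]_(y in [set x]) g y = g x.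
Proof.
move=> gx; rewrite (eq_integral (cst (g x))); last by move=> y; rewrite inE => ->.
rewrite integral_cst//= /counting asboolT// fset_set1 cardfs1 mule1//.
Qed.

(** Countability splits the space into a sequence of pieces with at most one point, over which the
    integral is additive. *)
Lemma integral_counting_esum g : (forall x, 0 <= g x) ->
  \int[mu]_x g x = \esum_(x in [set: T]) g x.
Proof.
move=> g0; have /countable_injP[e inj_e] := countT.
pose F n := [set x | e x = n].
have tF : trivIset setT F by move=> m n _ _ [x [<- <-]].
have <- : \bigcup_n F n = [set: T].
  by apply/seteqP; split=> // x _; exists (e x).
rewrite ge0_integral_bigcup// esum_bigcupT//.
rewrite nneseries_esumT; last by move=> n; exact: integral_ge0.
apply: eq_esum => n _.
have [->|/set0P[x Fx]] := eqVneq (F n) set0; first by rewrite integral_set0 esum_set0.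
have -> : F n = [set x].
  apply/seteqP; split=> [y Fy|y ->//].
  by apply: inj_e; rewrite ?inE//; rewrite [e y]Fy [e x]Fx.
by rewrite integral_counting_set1// esum_set1.
Qed.

Lemma integral_counting_seq s g : (forall x, 0 <= g x) -> uniq s ->
  \int[mu]_(x in [set` s]) g x = \sum_(x <- s) g x.
Proof.
move=> g0 us; rewrite integral_mkcond integral_counting_esum; last first.
  by move=> x; rewrite patchE; case: ifP.
rewrite -esum_mkcond esum_fset//; last by move=> *; exact: finite_seq.
by rewrite -fsbig_seq.
Qed.

Lemma counting_seq s : uniq s -> mu [set` s] = (size s)%:R%:E.
Proof.
move=> us; have := integral_cst mu (vertices_measurable [set` s]) 1.
rewrite mul1e integral_counting_seq// => <-.
by rewrite sumEFin big_const_seq count_predT iter_addr_0.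
Qed.

(** A singleton has mass 1, so a null set is empty. *)
Lemma ae_counting (P : T -> Prop) : {ae mu, forall x, P x} -> forall x, P x.
Proof.
move=> [A [_ A0 PA]] x; apply: contrapT => nPx.
have : mu [set x] <= mu A by apply: le_measure; rewrite ?inE// => _ ->; exact: PA.
have -> : [set x] = [set` [:: x]].
  by apply/seteqP; split=> y /=; rewrite inE => /eqP.
by rewrite A0 counting_seq// lee_fin ler10.
Qed.

(** Rearranges a nonnegative sum along the fibres of [e]. With [e] an iterate of the parent map,
    inequalities on single generations integrate to the whole tree. *)
Lemma integral_counting_fibres (F : T -> seq T) (e : T -> T) g :
  (forall x, 0 <= g x) -> (forall x, uniq (F x)) ->
  (forall x y, (y \in F x) = (e y == x)) ->
  \int[mu]_y g y = \int[mu]_x \sum_(y <- F x) g y.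
Proof.
move=> g0 uF memF; rewrite !integral_counting_esum//; last first.
  by move=> x; apply: sume_ge0.
transitivity (\esum_(x in [set: T]) \esum_(y in [set` F x]) g y).
  rewrite esum_esum//; apply/esym.
  rewrite (@reindex_esum _ _ _ [set: T] _ (fun y => (e y, y)))//; split.
  - by move=> y _; split; rewrite //= memF.
  - by move=> y z _ _ [_ ->].
  - by move=> [x y] [_ /=]; rewrite memF => /eqP <-; exists y.
apply: eq_esum => x _.
by rewrite esum_fset -?fsbig_seq// => *; exact: finite_seq.
Qed.

End counting_integral.

(** * Triangles of the tree as duplicate-free lists *)

Section tree_setting.
Variables (T : tree) (w : nat -> T).
Hypothesis lf : locally_finite T.
Hypothesis nu3 : forall x : T, (3 <= nu x)%N.
Hypothesis ray : geodesic_ray w.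

Definition children (x : T) : seq T := fset_set (successors w x).

Lemma successors_finite x : finite_set (successors w x).
Proof. by apply: sub_finite_set (lf x) => y []. Qed.

Lemma children_uniq x : uniq (children x).
Proof. exact: fset_uniq. Qed.

Lemma mem_children x y : (y \in children x) = (parent w y == x).
Proof.
rewrite /children in_fset_set; last exact: successors_finite.
by apply/idP/eqP; rewrite inE => /(successorsE ray).
Qed.

Lemma size_children x : size (children x) = (nu x).-1.
Proof.
rewrite /nu (neighboursE ray) fset_setU1; last exact: successors_finite.
rewrite cardfsU1 in_fset_set; last exact: successors_finite.
suff -> : parent w x \notin successors w x by [].
rewrite notin_setE => -[_]; rewrite (parentP ray _).2; lia.
Qed.

Lemma triangleE n x : triangle w n x = [set` tri children n x].
Proof.
apply/seteqP; split=> y.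
  move=> [k kn /(nsuccessorsE ray) yx].
  by apply/(mem_tri mem_children); exists k.
move=> /(mem_tri mem_children)[k kn yx].
by exists k => //; apply/(nsuccessorsE ray).
Qed.

(** The height difference from [x] recovers the generation. *)
Lemma tri_uniq n x : uniq (tri children n x).
Proof.
apply: (uniq_flatten_map (g := fun y => `|height w x - height w y|%N)).
- exact: iota_uniq.
- by move=> k; exact: (desc_uniq children_uniq mem_children).
- move=> k y; rewrite (mem_desc mem_children) => /eqP <-.
  by rewrite (height_iter_parent ray); lia.
Qed.

End tree_setting.

(** * Strong type *)

Section geometric.
Local Open Scope ereal_scope.
Variable R : realType.

Lemma nneseries_geometric_le (x : R) (A : \bar R) (u : nat -> \bar R) :
  (0 <= x < 1)%R -> 0 <= A -> (forall i, 0 <= u i) ->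
  (forall i, u i <= (x ^+ i)%:E * A) ->
  \sum_(i <oo) u i <= ((1 - x)^-1)%:E * A.
Proof.
move=> /andP[x0 x1] A0 u0 uA; have x1' : (0 < 1 - x)%R by rewrite subr_gt0.
apply: lime_le; first by apply: is_cvg_nneseries => *; exact: u0.
apply: nearW => n; apply: (@le_trans _ _ (\sum_(0 <= i < n) (x ^+ i)%:E * A)).
  by apply: lee_sum => i _; exact: uA.
rewrite -ge0_sume_distrl; last by move=> i _; rewrite lee_fin exprn_ge0.
rewrite sumEFin lee_wpmul2r// lee_fin.
have -> : (\sum_(0 <= i < n) x ^+ i = (1 - x ^+ n) / (1 - x))%R.
  elim: n => [|n IHn]; first by rewrite big_geq// expr0 subrr mul0r.
  by rewrite big_nat_recr//= IHn exprS; field; rewrite gt_eqF.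
by rewrite ler_pdivrMr// mulVf ?gt_eqF// gerBl exprn_ge0.
Qed.

End geometric.

Section strong_type.
Variables (T : tree) (w : nat -> T).
Hypothesis lf : locally_finite T.
Hypothesis nu3 : forall x : T, (3 <= nu x)%N.
Hypothesis ray : geodesic_ray w.
Variable R : realType.
Local Notation mu := (@counting T R).
Local Notation par := (parent w).
Local Notation ch := (children w).

Let cT : countable [set: T] := locally_finite_countable lf.
Let uch : forall x, uniq (ch x) := children_uniq w.
Let mch : forall x y, (y \in ch x) = (par y == x) := mem_children lf ray.
Let sch x : (2 <= size (ch x))%N.
Proof. by rewrite (size_children lf ray); case: (nu x) (nu3 x). Qed.

Lemma integral_desc k (g : T -> \bar R) : (forall x, 0 <= g x)%E ->
  (\int[mu]_y g y = \int[mu]_x \sum_(y <- desc ch k x) g y)%E.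
Proof.
move=> g0; apply: (integral_counting_fibres cT (e := iter k par)) => //.
  by move=> x; exact: (desc_uniq uch mch).
by move=> x y; exact: mem_desc.
Qed.

Variable p : R.
Hypothesis p1 : 1 < p.
Let p0 : 0 < p. Proof. exact: lt_trans p1. Qed.

(** For nonnegative [f], the p-th power of M f; powers are taken of finite averages, before a
    supremum that may be infinite. *)
Definition horo_max (f : T -> R) (y : T) : \bar R :=
  ereal_sup (range (fun k => (avg ch k f (iter k par y) `^ p)%:E)).

Lemma horo_max_ge k f y :
  ((avg ch k f (iter k par y) `^ p)%:E <= horo_max f y)%E.
Proof. by apply: ereal_sup_ubound; exists k. Qed.

Lemma horo_max_ge0 f y : (0 <= horo_max f y)%E.
Proof. by apply: le_trans (horo_max_ge 0 f y); rewrite lee_fin powR_ge0. Qed.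

(** Doob's inequality on each [desc k x] integrates to a bound, uniform in k, for the maximum over
    ancestors of order at most k; monotone convergence removes the truncation. *)
Lemma integral_horo_max f : (forall y, 0 <= f y) ->
  (\int[mu]_y horo_max f y <=
   (doob_cst p)%:E * \int[mu]_y (f y `^ p)%:E)%E.
Proof.
move=> f0; pose g k y := (dmax par ch k 0 f y `^ p)%:E.
have dmax0 k y : 0 <= dmax par ch k 0 f y by exact: dmax_ge.
have g0 k y : (0 <= g k y)%E by rewrite lee_fin powR_ge0.
have dC0 := doob_cst_ge0 p1.
have gmono y : {homo g ^~ y : n m / (n <= m)%N >-> (n <= m)%E}.
  move=> n m nm; rewrite lee_fin ge0_ler_powR ?nnegrE ?(ltW p0)//.
  exact: dmax_le.
have intg k : (\int[mu]_y g k y <= (doob_cst p)%:E * \int[mu]_y (f y `^ p)%:E)%E.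
  rewrite (integral_desc k); last exact: g0.
  rewrite [X in (_ <= _ * X)%E](integral_desc k); last first.
    by move=> y; rewrite lee_fin powR_ge0.
  rewrite -ge0_integralZl//; last first.
    by move=> x _; apply: sume_ge0 => y _; rewrite lee_fin powR_ge0.
  apply: ge0_le_integral => //.
    by move=> x _; apply: sume_ge0 => y _; exact: g0.
  move=> x _; rewrite !sumEFin -EFinM lee_fin.
  exact: (sum_dmax_powR mch sch).
apply: (@le_trans _ _ (\int[mu]_y limn (g ^~ y))%E).
  apply: ge0_le_integral => //; first by move=> y _; exact: horo_max_ge0.
  move=> y _; apply: ge_ereal_sup => _ [k _ <-].
  apply: lime_ge; first exact: ereal_nondecreasing_is_cvgn.
  exists k => // n /= kn; apply: le_trans (gmono _ _ _ kn).
  rewrite lee_fin ge0_ler_powR ?nnegrE ?(ltW p0)//; first exact: avg_ge0.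
  exact: avg_le_dmax.
rewrite monotone_convergence//.
apply: lime_le; last by apply: nearW.
apply: ereal_nondecreasing_is_cvgn => n m nm.
by apply: ge0_le_integral => // y _; exact: gmono.
Qed.

(* The gain 2^(1-p) per generation equals rho^2: one factor rho pays for the
   weights rho^-i of the majorant, the other one makes its integral converge. *)
Let rho : R := 2 `^ (- ((p - 1) / 2)).
Let r : R := rho `^ p^-1.

Let rho_gt0 : 0 < rho. Proof. by rewrite powR_gt0. Qed.

Let rho_lt1 : rho < 1.
Proof.
rewrite /rho powRN invf_lt1 ?powR_gt0//.
have x0 : 0 < (p - 1) / 2 by rewrite divr_gt0// subr_gt0.
have := gt0_ltr_powR x0 (ler01 : 1 \in Num.nneg) (ler0n R 2 : 2 \in Num.nneg) (ltr1n R 2).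
by rewrite powR1.
Qed.

Let r_ge0 : 0 <= r. Proof. exact: powR_ge0. Qed.

Let rp : r `^ p = rho.
Proof. by rewrite /r -powRrM mulVf ?gt_eqF// powRr1// ltW. Qed.

Let r_lt1 : r < 1.
Proof.
rewrite ltNge; apply/negP => r1.
have := ge0_ler_powR (ltW p0) ler01 r_ge0 r1.
by rewrite powR1 rp leNgt rho_lt1.
Qed.

Let pow2 i : (2 ^+ i) `^ (1 - p) = (rho ^+ 2) ^+ i.
Proof.
have -> : rho ^+ 2 = 2 `^ (1 - p).
  by rewrite -powR_mulrn ?powR_ge0// -powRrM; congr (_ `^ _); field.
by rewrite -!powR_mulrn ?powR_ge0// -!powRrM mulrC.
Qed.

(** With N = |s^i(x)|, the p-th powers over s^i(x) sum to N^(1-p) f(x)^p, at most 2^(i(1-p)) f(x)^p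
    since 1 - p < 0 and N >= 2^i. *)
Lemma integral_spread i f : (forall y, 0 <= f y) ->
  (\int[mu]_y (spread par ch i f y `^ p)%:E <=
   ((rho ^+ 2) ^+ i)%:E * \int[mu]_y (f y `^ p)%:E)%E.
Proof.
move=> f0; rewrite (integral_desc i); last by move=> y; rewrite lee_fin powR_ge0.
rewrite -ge0_integralZl//; [|by move=> x _; rewrite lee_fin powR_ge0
                          |by rewrite lee_fin !exprn_ge0// ltW].
apply: ge0_le_integral => //.
  by move=> x _; apply: sume_ge0 => y _; rewrite lee_fin powR_ge0.
move=> x _; rewrite sumEFin -EFinM lee_fin.
have N0 := ndesc_gt0 sch R i x.
rewrite (eq_big_seq (fun=> (f x / ndesc ch R i x) `^ p)); last first.
  by move=> y; rewrite (mem_desc mch) /spread => /eqP ->.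
rewrite big_const_seq count_predT iter_addr_0 -mulr_natr -/(ndesc ch R i x).
rewrite powRM ?invr_ge0 ?(ltW N0)// -(powR_inv1 (ltW N0)) -powRrM mulN1r.
rewrite -mulrA -{2}(powRr1 (ltW N0)) -powRD ?(gt_eqF N0) ?implybT// mulrC.
rewrite ler_wpM2r ?powR_ge0// -pow2 addrC.
rewrite -opprB !powRN lef_pV2 ?posrE ?powR_gt0 ?exprn_gt0//.
rewrite ge0_ler_powR ?nnegrE ?exprn_ge0 ?subr_ge0 ?(ltW p1) ?(ltW N0)//.
exact: ndesc_geX.
Qed.

Lemma average_tri (f : T -> R) n x :
  average f (triangle w n x) =
  ((size (tri ch n x))%:R^-1 * \sum_(y <- tri ch n x) `|f y|)%:E.
Proof.
rewrite /average (triangleE lf ray); have ut := tri_uniq lf ray n x.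
rewrite (counting_seq R cT)// (integral_counting_seq cT)//.
rewrite inver; case: eqP => [e|_]; last by rewrite sumEFin EFinM.
have : x \in tri ch n x by apply/(mem_tri mch); exists 0%N.
by case: (tri ch n x) e => [|y s] // /eqP; rewrite pnatr_eq0.
Qed.

(** Dominates, up to a constant, the p-th powers of all triangle averages at [y]: the first series
    serves generations level with or below [y], the second those above. Series, unlike suprema,
    integrate term by term. *)
Definition majorant f (y : T) : \bar R :=
  (\sum_(i <oo) ((2^-1 ^+ i)%:E * \sum_(z <- desc ch i y) horo_max f z) +
   \sum_(i <oo) (((rho ^+ i)^-1)%:E * horo_max (spread par ch i f) y))%E.

Let below_ge0 f i y :
  (0 <= (2^-1 ^+ i)%:E * \sum_(z <- desc ch i y) horo_max f z)%E.
Proof.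
rewrite mule_ge0// ?lee_fin ?exprn_ge0// sume_ge0// => z _.
exact: horo_max_ge0.
Qed.

Let above_ge0 f i y :
  (0 <= ((rho ^+ i)^-1)%:E * horo_max (spread par ch i f) y)%E.
Proof. by rewrite mule_ge0 ?horo_max_ge0// lee_fin invr_ge0 exprn_ge0// ltW. Qed.

Lemma majorant_ge0 f y : (0 <= majorant f y)%E.
Proof. by rewrite adde_ge0// nneseries_ge0. Qed.

Lemma majorant_ge_below f i y :
  ((2^-1 ^+ i)%:E * \sum_(z <- desc ch i y) horo_max f z <= majorant f y)%E.
Proof.
apply: le_trans (leeDl _ _); last by rewrite nneseries_ge0.
apply: le_trans (nneseries_lim_ge i.+1 _) => //.
by rewrite big_nat_recr//= leeDr// sume_ge0.
Qed.

Lemma majorant_ge_above f i y :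
  (((rho ^+ i)^-1)%:E * horo_max (spread par ch i f) y <= majorant f y)%E.
Proof.
apply: le_trans (leeDr _ _); last by rewrite nneseries_ge0.
apply: le_trans (nneseries_lim_ge i.+1 _) => //.
by rewrite big_nat_recr//= leeDr// sume_ge0.
Qed.

(** After Doob's inequality, the first series costs the sum of the weights 2^-i, which is 2, since
    summing over generations preserves the integral. In the second, rho^-i against the gain rho^(2i)
    leaves rho^i. *)
Lemma integral_majorant f : (forall y, 0 <= f y) ->
  (\int[mu]_y majorant f y <=
   (doob_cst p * (2 + (1 - rho)^-1))%:E * \int[mu]_y (f y `^ p)%:E)%E.
Proof.
move=> f0; set I := (\int[mu]_y (f y `^ p)%:E)%E.
have I0 : (0 <= I)%E by apply: integral_ge0 => y _; rewrite lee_fin powR_ge0.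
have dC0 := doob_cst_ge0 p1.
have CI0 : (0 <= (doob_cst p)%:E * I)%E by rewrite mule_ge0.
rewrite ge0_integralD//; [|by move=> *; rewrite nneseries_ge0..].
have dC2 : 0 <= doob_cst p * 2 by exact: mulr_ge0.
have dCrho : 0 <= doob_cst p * (1 - rho)^-1.
  by apply: mulr_ge0; rewrite // invr_ge0 subr_ge0 ltW.
rewrite mulrDr EFinD ge0_muleDl ?lee_fin//.
rewrite !integral_nneseries//; apply: leeD.
  have -> : ((doob_cst p * 2)%:E * I = ((1 - 2^-1)^-1)%:E * ((doob_cst p)%:E * I))%E.
    by rewrite muleA -EFinM; congr (_%:E * _)%E; field.
  apply: nneseries_geometric_le => //; first by apply/andP; split; lra.
    by move=> i; apply: integral_ge0.
  move=> i; rewrite ge0_integralZl//; last first.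
    by move=> x _; apply: sume_ge0 => z _; exact: horo_max_ge0.
  rewrite -integral_desc; last by move=> z; exact: horo_max_ge0.
  by rewrite lee_pmul2l ?lte_fin ?exprn_gt0// integral_horo_max.
rewrite mulrC EFinM -muleA.
apply: nneseries_geometric_le => //; first by rewrite (ltW rho_gt0) rho_lt1.
  by move=> i; apply: integral_ge0.
move=> i; have ri0 : 0 < rho ^+ i by rewrite exprn_gt0.
rewrite ge0_integralZl//; [|by move=> x _; exact: horo_max_ge0
                         |by rewrite lee_fin invr_ge0 ltW].
apply: (@le_trans _ _
  (((rho ^+ i)^-1)%:E * ((doob_cst p)%:E * (((rho ^+ 2) ^+ i)%:E * I)))%E).
  rewrite lee_pmul2l ?lte_fin ?invr_gt0//.
  apply: le_trans (integral_horo_max _) _; first by move=> y; exact: spread_ge0.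
  by rewrite lee_wpmul2l// integral_spread.
rewrite !muleA -!EFinM -exprM mulnC exprM.
by rewrite (_ : (rho ^+ i)^-1 * _ * _ = rho ^+ i * doob_cst p)//; field; rewrite gt_eqF.
Qed.

Let c : R := 1 + (1 - r)^-1.

Let c_gt0 : 0 < c. Proof. by rewrite ltr_wpDr// invr_ge0 subr_ge0 ltW. Qed.

(** Applies [tri_avg_le] with [B] the p-th root of the majorant at [y], the case of an infinite
    majorant being trivial. *)
Lemma average_powR_le_majorant (f : T -> R) n x y : triangle w n x y ->
  (average f (triangle w n x) `^ p <=
   (c `^ p)%:E * majorant (fun z => `|f z|%R) y)%E.
Proof.
rewrite {1}(triangleE lf ray) /= => /(mem_tri mch)[j jn yx].
set g := fun z => `|f z|; have g0 z : 0 <= g z by exact: normr_ge0.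
case Qq : (majorant g y) (majorant_ge0 g y) => [q| |]//; last first.
  by move=> _; rewrite gt0_muley ?leey// lte_fin powR_gt0.
rewrite lee_fin => q0; rewrite average_tri poweR_EFin -EFinM lee_fin.
pose B := q `^ p^-1; have B0 : 0 <= B by exact: powR_ge0.
have Bp : B `^ p = q by rewrite /B -powRrM mulVf ?gt_eqF// powRr1.
rewrite -Bp -powRM ?(ltW c_gt0)//.
have tri0 : (0 < size (tri ch n x))%N.
  have : x \in tri ch n x by apply/(mem_tri mch); exists 0%N.
  by case: (tri ch n x).
rewrite ge0_ler_powR ?nnegrE ?(ltW p0) ?mulr_ge0 ?(ltW c_gt0) ?invr_ge0 ?sumr_ge0//.
rewrite mulrC ler_pdivrMr ?ltr0n//.
have powR_root a b : 0 <= a -> 0 <= b -> a `^ p <= b -> a <= b `^ p^-1.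
  move=> a0 b0 ab; rewrite -[leLHS](powRr1 a0) -(mulfV (lt0r_neq0 p0)) powRrM.
  by rewrite ge0_ler_powR ?nnegrE ?powR_ge0// invr_ge0 ltW.
apply: (tri_avg_le mch sch _ _ _ jn) => //; first by rewrite r_ge0.
(* Every [z] in generation k - j below [y] has [x] as ancestor of order k, so its maximal function
   sees this average; at least 2^(k-j) such [z] offset the weight. *)
- move=> k jk; apply: powR_root => //; first exact: avg_ge0.
  have := majorant_ge_below g (k - j) y; rewrite Qq => H.
  rewrite -lee_fin; apply: le_trans H.
  set A := avg ch k g x `^ p.
  apply: (@le_trans _ _ ((2^-1 ^+ (k - j))%:E * \sum_(z <- desc ch (k - j) y) A%:E)%E).
    rewrite sumEFin -EFinM lee_fin big_const_seq count_predT iter_addr_0 -(mulr_natr A).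
    rewrite -/(ndesc ch R (k - j) y) mulrCA ler_peMr ?powR_ge0//.
    rewrite exprVn mulrC ler_pdivlMr ?exprn_gt0// mul1r.
    exact: ndesc_geX.
  rewrite lee_pmul2l ?lte_fin ?exprn_gt0//.
  rewrite big_seq [leRHS]big_seq; apply: lee_sum => z.
  rewrite (mem_desc mch) => /eqP zy; apply: le_trans (horo_max_ge k g z).
  by rewrite -(subnKC jk) iterD subnKC// zy yx.
(* As [x] is the ancestor of order j of [y], this average enters the maximal function of the spread
   function at [y]; the weight rho^-i yields the decay. *)
- move=> i ij.
  have -> : r ^+ i * B = (rho ^+ i * q) `^ p^-1.
    rewrite powRM ?exprn_ge0 ?(ltW rho_gt0)//; congr (_ * _).
    rewrite -powR_mulrn// -powR_mulrn ?(ltW rho_gt0)// /r -!powRrM.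
    by congr (_ `^ _); field; rewrite gt_eqF.
  apply: powR_root; [by apply: avg_ge0 => z; exact: spread_ge0|..].
    by rewrite mulr_ge0// exprn_ge0// ltW.
  have := majorant_ge_above g i y; rewrite Qq => H.
  rewrite mulrC -ler_pdivrMr ?exprn_gt0// -lee_fin mulrC EFinM.
  apply: le_trans H; rewrite lee_pmul2l ?lte_fin ?invr_gt0 ?exprn_gt0//.
  by have := horo_max_ge j (spread par ch i g) y; rewrite yx.
Qed.

Lemma average_ge0 (f : T -> R) n x : (0 <= average f (triangle w n x))%E.
Proof. by rewrite average_tri lee_fin mulr_ge0 ?invr_ge0// sumr_ge0. Qed.

Lemma maximal_ge0 (f : T -> R) y : (0 <= maximal w f y)%E.
Proof.
apply: (@le_trans _ _ (average f (triangle w 0 y))); first exact: average_ge0.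
apply: ereal_sup_ubound; exists (triangle w 0 y) => //; split; first by exists y, 0%N.
by rewrite (triangleE lf ray); apply/(mem_tri mch); exists 0%N.
Qed.

Lemma maximal_powR_le_majorant (f : T -> R) y :
  (maximal w f y `^ p <= (c `^ p)%:E * majorant (fun z => `|f z|%R) y)%E.
Proof.
set Q := (_ * _)%E; have Q0 : (0 <= Q)%E.
  by rewrite mule_ge0 ?majorant_ge0// lee_fin powR_ge0.
(* Writing the bound as a p-th power reduces the claim to bounding each average by its p-th root. *)
have QQ : Q = (Q `^ p^-1 `^ p)%E by rewrite -poweRrM mulVf ?gt_eqF// poweRe1.
rewrite [leRHS]QQ gt0_ler_poweR ?(ltW p0)//.
- by rewrite in_itv/= maximal_ge0 leey.
- by rewrite in_itv/= poweR_ge0 leey.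
apply: ge_ereal_sup => _ [_ [[x [n ->]] nxy] <-].
have := average_powR_le_majorant f nxy; rewrite -/Q => H.
rewrite -[leLHS]poweRe1 ?average_ge0// -(mulfV (lt0r_neq0 p0)) poweRrM.
by rewrite gt0_ler_poweR ?invr_ge0 ?(ltW p0)// in_itv/= ?poweR_ge0 ?leey ?Q0.
Qed.

Lemma maximal_bounded_finite : bounded_on_Lp w p%:E.
Proof.
pose C := c `^ p * (doob_cst p * (2 + (1 - rho)^-1)).
have C0 : 0 <= C.
  rewrite mulr_ge0 ?powR_ge0// mulr_ge0 ?doob_cst_ge0//.
  by rewrite addr_ge0// invr_ge0 subr_ge0 ltW.
exists (C `^ p^-1) => f _.
rewrite unlock /Lnorm /=.
set I := (\int[mu]_y (`|f y|%:E `^ p)%E)%E.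
have I0 : (0 <= I)%E by apply: integral_ge0 => y _; exact: poweR_ge0.
rewrite -poweR_EFin -poweRM ?lee_fin//.
rewrite gt0_ler_poweR ?invr_ge0 ?(ltW p0)//.
- by rewrite in_itv/= leey integral_ge0// => y _; exact: poweR_ge0.
- by rewrite in_itv/= leey mule_ge0.
apply: (@le_trans _ _ (\int[mu]_y ((c `^ p)%:E * majorant (fun z => `|f z|%R) y))%E).
  apply: ge0_le_integral => //; first by move=> y _; exact: poweR_ge0.
  by move=> y _; rewrite gee0_abs ?maximal_ge0// maximal_powR_le_majorant.
rewrite ge0_integralZl//; [|by move=> y _; exact: majorant_ge0
                         |by rewrite lee_fin powR_ge0].
rewrite /C EFinM -muleA lee_wpmul2l ?lee_fin ?powR_ge0//.
exact: integral_majorant.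
Qed.

Lemma maximal_bounded_infty : bounded_on_Lp w (+oo%E : \bar R).
Proof.
exists 1 => f _; rewrite mul1e unlock /Lnorm /=.
(* The norm for p = +oo is the essential supremum if the space has positive measure, and 0
   otherwise. *)
case: ifPn => // _; set S := ess_sup _ (abse \o (EFin \o f)).
have fS y : (`|f y|%:E <= S)%E.
  exact: (ae_counting cT (ess_sup_ge mu (abse \o (EFin \o f)))).
apply/ess_supP/aeW => y /=; rewrite gee0_abs ?maximal_ge0//.
apply: ge_ereal_sup => _ [_ [[x [n ->]] _] <-].
case: S fS => [s| |] fS; last 2 first.
- by rewrite leey.
- by have := fS y.
have s0 : 0 <= s by have := fS y; rewrite lee_fin; apply: le_trans.
rewrite average_tri lee_fin mulrC; set l := tri ch n x.
have [->|l0] := eqVneq (size l) 0%N; first by rewrite invr0 mulr0.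
rewrite ler_pdivrMr ?ltr0n ?lt0n// mulr_natr.
rewrite -iter_addr_0 -[X in iter X _ _](count_predT l) -big_const_seq.
by apply: ler_sum => z _; rewrite -lee_fin.
Qed.

End strong_type.

(** * Failure of weak type *)

Section weak_type_failure.
Variables (b : nat) (T : tree) (w : nat -> T).
Hypothesis b2 : (2 <= b)%N.
Hypothesis hb : homogeneous b T.
Hypothesis ray : geodesic_ray w.
Variable R : realType.
Local Notation mu := (@counting T R).
Local Notation par := (parent w).
Local Notation ch := (children w).

Let lf : locally_finite T := hb.1.
Let cT : countable [set: T] := locally_finite_countable lf.
Let uch : forall x, uniq (ch x) := children_uniq w.
Let mch : forall x y, (y \in ch x) = (par y == x) := mem_children lf ray.

Lemma size_desc k x : size (desc ch k x) = (b ^ k)%N.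
Proof.
elim: k x => // k IHk x.
rewrite -sum1_size big_desc (eq_bigr (fun=> b ^ k)%N); last first.
  by move=> c _; rewrite sum1_size IHk.
by rewrite big_const_seq count_predT iter_addn_0 (size_children lf ray) hb.2 expnSr.
Qed.

(** The induction closes because 2 b^n + b^(n+1) <= 2 b^(n+1) when b >= 2. *)
Lemma size_tri_le n x : (size (tri ch n x) <= 2 * b ^ n)%N.
Proof.
rewrite size_flatten /shape -map_comp sumnE big_map.
rewrite (eq_bigr (fun k => b ^ k)%N); last by move=> k _; rewrite /= size_desc.
elim: n => [|n IHn]; first by rewrite big_seq1.
rewrite -[in iota _ _]addn1 iotaD big_cat big_seq1 /= add0n expnS.
have : (2 * b ^ n <= b * b ^ n)%N by rewrite leq_mul2r b2 orbT.
by move: IHn; rewrite -[iota 0 n.+1]/(0%N :: iota 1 n); lia.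
Qed.

(** A vertex [n] generations below the ancestor of order k has height h(x) + k - n, which determines
    k. *)
Lemma upper_horocycles_uniq n x :
  uniq (flatten [seq desc ch n (iter k par x) | k <- iota 0 n.+1]).
Proof.
apply: (uniq_flatten_map (g := fun y => absz (height w y + n%:Z - height w x)%R)).
- exact: iota_uniq.
- by move=> k; exact: (desc_uniq uch mch).
- move=> k y; rewrite (mem_desc mch) => /eqP yk.
  have := height_iter_parent ray n y; rewrite yk (height_iter_parent ray); lia.
Qed.

Lemma not_weak_type : ~ weak_type_1_1 R w.
Proof.
move=> [C weak]; pose o : T := point; pose f y : R := (y == o)%:R.
have f1 : ('N[mu]_1[EFin \o f] = 1)%E.
  rewrite Lnorm1; transitivity (\int[mu]_(y in [set o]) (cst 1 y))%E; last first.
    by rewrite integral_counting_set1.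
  rewrite [RHS]integral_mkcond.
  apply: eq_integral => y _ /=; rewrite patchE /f.
  case: eqP => [->|yo]; first by rewrite mem_set// normr1.
  by rewrite memNset// normr0.
(* The weak type bound will force n + 1 <= 4 C. *)
have [n nC] : exists n : nat, 4 * `|C| < n%:R.
  by exists (Num.bound (4 * `|C|)); rewrite archi_boundP// mulr_ge0.
(* Half of the lower bound 1 / (2 b^n) for the averages, so that the level is exceeded strictly. *)
pose a : R := (4 * (b ^ n)%:R)^-1.
have bn0 : 0 < (b ^ n)%:R :> R by rewrite ltr0n expn_gt0 (leq_trans _ b2).
have a0 : 0 < a by rewrite invr_gt0 mulr_gt0.
have := weak f a; rewrite /finite_norm f1 ltry => /(_ isT a0).
pose l := flatten [seq desc ch n (iter k par o) | k <- iota 0 n.+1].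
have ul : uniq l by exact: upper_horocycles_uniq.
have sl : size l = (n.+1 * b ^ n)%N.
  rewrite size_flatten /shape -map_comp sumnE big_map.
  rewrite (eq_bigr (fun k => b ^ n)%N); last by move=> k _; rewrite /= size_desc.
  by rewrite big_const_seq count_predT iter_addn_0 size_iota mulnC.
have la : [set` l] `<=` [set x | (a%:E < maximal w f x)%E].
  move=> y /flatten_mapP[k]; rewrite mem_iota add0n /= => kn.
  rewrite (mem_desc mch) => /eqP yk; set x := iter k par o in yk.
  (* The triangle of height [n] at [x] contains [y], and also [o] because k <= n. *)
  apply: (@lt_le_trans _ _ (average f (triangle w n x))); last first.
    apply: ereal_sup_ubound; exists (triangle w n x) => //; split.
      by exists x, n.
    by rewrite (triangleE lf ray); apply/(mem_tri mch); exists n.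
  have oT : o \in tri ch n x by apply/(mem_tri mch); exists k.
  rewrite (average_tri lf ray) lte_fin (bigD1_seq o)//=; last exact: (tri_uniq lf ray).
  rewrite /f eqxx normr1 big1 ?addr0 ?mulr1; last first.
    by move=> z /negPf ->; rewrite normr0.
  have T0 : (0 < size (tri ch n x))%N by case: (tri ch n x) oT.
  have Tb : (size (tri ch n x))%:R <= 2 * (b ^ n)%:R :> R.
    by rewrite -[2]/(2%:R) -natrM ler_nat size_tri_le.
  have T0R : 0 < (size (tri ch n x))%:R :> R by rewrite ltr0n.
  move: Tb T0R; set t := (size _)%:R => Tb t0.
  by rewrite /a ltf_pV2 ?posrE ?mulr_gt0//; lra.
rewrite mule1 inver gt_eqF// -EFinM invrK => H.
have {H} : (mu [set` l] <= (C * (4 * (b ^ n)%:R))%:E)%E.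
  by apply: le_trans H; apply: le_measure; rewrite ?inE.
rewrite (counting_seq R cT)// sl lee_fin natrM mulrA ler_pM2r//.
have := ler_norm C; rewrite -natr1; lra.
Qed.

End weak_type_failure.

Theorem theorem4p3 (R : realType) :
  (forall (T : tree) (w : nat -> T),
     locally_finite T -> (forall x : T, (3 <= nu x)%N) -> geodesic_ray w ->
     forall p : \bar R, (1 < p)%E -> bounded_on_Lp w p)
  /\
  (forall (b : nat) (T : tree) (w : nat -> T),
     (2 <= b)%N -> homogeneous b T -> geodesic_ray w ->
     ~ weak_type_1_1 R w).
Proof.
split=> [T w lf nu3 ray [p| |] p1|b T w b2 hb ray].
- exact: (maximal_bounded_finite lf nu3 ray p1).
- exact: (maximal_bounded_infty lf ray).
- by [].
- exact: (not_weak_type b2 hb ray).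
Qed.
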